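(* Let $\mathfrak C$ be a left cancellative small category. The following are equivalent: (i) $I_l\ltimes\partial\Omega$ is minimal. (ii) $I_l\,\bar\ltimes\,\partial\Omega$ is minimal. (iii) For all non-empty $e,f\in\mathcal J$ there exist $s_1,\dots,s_n\in I_l$ such that for all non-empty $e'\in\mathcal J$ with $e'\le e$ there exists $1\le i\le n$ with $e'(s_ifs_i^{-1})\ne\emptyset$.
   Context: $\mathfrak C$ denotes the set of morphisms, $\mathfrak C^0\subseteq\mathfrak C$ the identity morphisms, $\mathfrak d,\mathfrak t$ domain and target; $cd$ is defined iff $\mathfrak d(c)=\mathfrak t(d)$; left cancellative means $cx=cy\Rightarrow x=y$. Each $c\in\mathfrak C$ gives the partial bijection $\mathfrak d(c)\mathfrak C\to c\mathfrak C$, $x\mapsto cx$; $I_l$ is the smallest semigroup of partial bijections of $\mathfrak C$ containing these and closed under inverses; $\mathcal J=\{\mathrm{dom}(s):s\in I_l\}$ is its semilattice of idempotents (product = intersection, $\le$ = inclusion; $sfs^{-1}$ corresponds to the set $s(f\cap\mathrm{dom}(s))$). $\bar{\mathcal J}$ is the set of subsets $\varepsilon=e\setminus\bigcup_{i=1}^nf_i$ with $e,f_i\in\mathcal J$, $f_i\subseteq e$. $\widehat{\mathcal J}$ is the space of non-zero multiplicative maps $\chi:\mathcal J\to\{0,1\}$ with $\chi(\emptyset)=0$ if $\emptyset\in\mathcal J$ (pointwise convergence). $\Omega\subseteq\widehat{\mathcal J}$ consists of those $\chi$ such that whenever $e=\bigcup_{i=1}^nf_i$ ($e,f_i\in\mathcal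 J$) and $\chi(e)=1$, then $\chi(f_i)=1$ for some $i$. For $\chi\in\Omega$, $\varepsilon=e\setminus\bigcup f_i$, put $\chi(\varepsilon)=1$ iff $\chi(e)=1$ and all $\chi(f_i)=0$, and $\chi(\varepsilon)=0$ otherwise. $\partial\Omega\subseteq\Omega$ is the closure of the set of $\chi\in\widehat{\mathcal J}$ with $\chi^{-1}(1)$ maximal. $s\in I_l$ acts by $\chi\mapsto s.\chi=\chi(s^{-1}\cdot s)$ from $\{\chi\in\partial\Omega:\chi(s^{-1}s)=1\}$ onto $\{\chi\in\partial\Omega:\chi(ss^{-1})=1\}$. $I_l\ltimes\partial\Omega$ (resp. $I_l\,\bar\ltimes\,\partial\Omega$) is the étale groupoid of classes of pairs $(s,\chi)$ with $\chi\in\partial\Omega$, $\chi(s^{-1}s)=1$, where $(s,\chi)$ and $(t,\psi)$ are identified iff $\chi=\psi$ and the restrictions satisfy $se=te$ for some $e\in\mathcal J$ with $\chi(e)=1$ (resp. $s\varepsilon=t\varepsilon$ for some $\varepsilon\in\bar{\mathcal J}$ with $\chi(\varepsilon)=1$); source $\chi$, range $s.\chi$; unit space $\partial\Omega$. A groupoid is minimal if its unit space has no closed invariant subsets other than $\emptyset$ and the whole unit space. *)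

(* Defs.v *)
(* Left cancellative small categories, their left inverse hulls I_l, the      *)
(* spaces of characters of J, and the two etale groupoids of germs            *)
(* (mathcomp-analysis).                                                       *)
From HB Require Import structures.
From mathcomp Require Import all_boot all_classical topology.

Set Implicit Arguments.
Unset Strict Implicit.
Unset Printing Implicit Defensive.

Local Open Scope classical_set_scope.
Local Open Scope quotient_scope.

(* A small category given by its set of morphisms only: the objects are       *)
(* identified with the identity morphisms, which are the values of [cdom]     *)
(* (equivalently of [ctgt]). The product [ccomp c d] is meaningful only when  *)
(* [cdom c = ctgt d]; other values are arbitrary and are never used.          *)
Record smallCategory := SmallCategory {
  mor :> Type ;
  cdom : mor -> mor ;
  ctgt : mor -> mor ;
  ccomp : mor -> mor -> mor ;
  cdom_dom : forall c, cdom (cdom c) = cdom c ;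
  ctgt_dom : forall c, ctgt (cdom c) = cdom c ;
  cdom_tgt : forall c, cdom (ctgt c) = ctgt c ;
  ctgt_tgt : forall c, ctgt (ctgt c) = ctgt c ;
  cdom_comp : forall c d, cdom c = ctgt d -> cdom (ccomp c d) = cdom d ;
  ctgt_comp : forall c d, cdom c = ctgt d -> ctgt (ccomp c d) = ctgt c ;
  ccomp1 : forall c, ccomp c (cdom c) = c ;
  comp1c : forall c, ccomp (ctgt c) c = c ;
  ccompA : forall a b c, cdom a = ctgt b -> cdom b = ctgt c ->
    ccomp a (ccomp b c) = ccomp (ccomp a b) c
}.

Definition left_cancellative (C : smallCategory) :=
  forall c x y : C, cdom c = ctgt x -> cdom c = ctgt y ->
    ccomp c x = ccomp c y -> x = y.

Record lcCategory := LcCategory {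
  lc_cat :> smallCategory ;
  lc_cancel : left_cancellative lc_cat
}.

(* ** Partial bijections, represented by their graphs *)
Section PartialBijections.
Variable T : Type.
Implicit Types (s t : set (T * T)) (A : set T).

Definition partial_bijection s :=
  (forall x y y', s (x, y) -> s (x, y') -> y = y') /\
  (forall x x' y, s (x, y) -> s (x', y) -> x = x').

Definition pcomp s t : set (T * T) :=
  [set p | exists2 z, t (p.1, z) & s (z, p.2)].

Definition pinv s : set (T * T) := [set p | s (p.2, p.1)].

(* s(A `&` dom s); for A in J, the set of the idempotent s A s^-1 *)
Definition pimg s A : set T := [set y | exists2 x, A x & s (x, y)].

Definition prestr s A : set (T * T) := [set p | s p /\ A p.1].

Definition pmap_semigroup (S : set (set (T * T))) :=
  (forall s t, S s -> S t -> S (pcomp s t)) /\ (forall s, S s -> S (pinv s)).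

Lemma pinvK s : pinv (pinv s) = s.
Proof. by apply/seteqP; split=> -[x y]. Qed.

Lemma pimg_pinvE s A x : pimg (pinv s) A x <-> exists2 y, s (x, y) & A y.
Proof. by split=> -[y]; exists y. Qed.

Lemma prestrP s t A :
  prestr s A = prestr t A <-> (forall x y, A x -> s (x, y) <-> t (x, y)).
Proof.
split=> [st x y Ax|st].
  by split=> h; [have [] : prestr t A (x, y) by rewrite -st
                |have [] : prestr s A (x, y) by rewrite st].
by apply/seteqP; split=> -[x y] [h Ax]; split=> //; exact/(st x y Ax).
Qed.

Lemma partial_bijection_comp s t : partial_bijection s -> partial_bijection t ->
  partial_bijection (pcomp s t).
Proof.
move=> [sf si] [tf ti]; split=> [x y y'|x x' y] [z /= h1 h2] [z' /= h3 h4].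
  by have ? := tf _ _ _ h1 h3; subst z'; exact: sf h2 h4.
by have ? := si _ _ _ h2 h4; subst z'; exact: ti h1 h3.
Qed.

Lemma partial_bijection_inv s : partial_bijection s -> partial_bijection (pinv s).
Proof.
by move=> [sf si]; split=> [x y y'|x x' y] h1 h2; [exact: si h1 h2|exact: sf h1 h2].
Qed.

End PartialBijections.

Section InverseHull.
Variable C : lcCategory.

Definition lmul (c : C) : set (C * C) :=
  [set p | cdom c = ctgt p.1 /\ p.2 = ccomp c p.1].

Definition Il : set (set (C * C)) := smallest (@pmap_semigroup C) (range lmul).

Lemma Il_semigroup : pmap_semigroup Il.
Proof.
split=> [s t hs ht M hM|s hs M hM]; have [[hc hi] _] := hM.
  by apply: hc; [exact: (hs M hM)|exact: (ht M hM)].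
by apply: hi; exact: (hs M hM).
Qed.

Lemma Il_comp s t : Il s -> Il t -> Il (pcomp s t).
Proof. by have [+ _] := Il_semigroup; apply. Qed.

Lemma Il_inv s : Il s -> Il (pinv s).
Proof. by have [_ +] := Il_semigroup; apply. Qed.

Lemma Il_bij s : Il s -> partial_bijection s.
Proof.
move: s; apply: smallest_sub.
  split; first exact: partial_bijection_comp.
  exact: partial_bijection_inv.
move=> _ [c _ <-]; split=> [x y y' [/= _ ->] [/= _ ->] //|x x' y [/= h1 ->] [/= h2]].
exact: lc_cancel.
Qed.

Definition J : set (set C) := [set s.`1 | s in Il].

Lemma J_img s e : Il s -> J e -> J (pimg s e).
Proof.
move=> hs [t ht <-]; exists (pcomp t (pinv s)).
  by apply: Il_comp => //; exact: Il_inv.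
apply/seteqP; split=> y /=.
  by move=> [z [x /= h1 h2]]; exists x => //; exists z.
by move=> [x [z h1] h2]; exists z, x.
Qed.

Lemma J_capI e f : J e -> J f -> J (e `&` f).
Proof.
move=> [s hs <-] [t ht <-]; exists (pcomp t (pcomp (pinv s) s)).
  by apply: Il_comp => //; apply: Il_comp => //; exact: Il_inv.
apply/seteqP; split=> x /=.
  move=> [z [x' [y /= h1 h2] h3]].
  have xx' : x = x' := (Il_bij hs).2 _ _ _ h1 h2.
  by subst x'; split; [exists y|exists z].
by move=> [[y h1] [z h2]]; exists z, x => //; exists y.
Qed.

Definition Jcap (e f : J) : J :=
  SigSub (mem_set (J_capI (set_valP e) (set_valP f))).

Definition Icomp (s t : Il) : Il :=
  SigSub (mem_set (Il_comp (set_valP s) (set_valP t))).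

Definition Iinv (s : Il) : Il := SigSub (mem_set (Il_inv (set_valP s))).

Definition Idom (s : Il) : J :=
  SigSub (mem_set (ex_intro2 _ _ (\val s) (set_valP s) erefl : J (\val s).`1)).

Definition Iconj (s : Il) (f : J) : J :=
  SigSub (mem_set (J_img (set_valP s) (set_valP f))).

End InverseHull.

Arguments Il C : clear implicits.
Arguments J C : clear implicits.

Section Characters.
Variable C : lcCategory.

Definition is_character : set {ptws J C -> bool} :=
  [set chi : {ptws J C -> bool} |
             [/\ exists e, chi e,
                 forall e f, chi (Jcap e f) = chi e && chi f &
                 forall e, \val e = set0 -> chi e = false]].

Definition Jhat : topologicalType := is_character.

Definition ev (chi : Jhat) (e : J C) : bool := \val chi e.

(* chi^-1(1) is maximal among the sets psi^-1(1), psi in Jhat *)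
Definition maximal_characters : set Jhat :=
  [set chi : Jhat | forall psi : Jhat,
     [set e | ev chi e] `<=` [set e | ev psi e] ->
     [set e | ev psi e] = [set e | ev chi e]].

Definition Omega : set Jhat :=
  [set chi : Jhat | forall (e : J C) (fs : seq (J C)),
     \val e = \bigcup_(f in [set` fs]) \val f -> ev chi e ->
     exists2 f, f \in fs & ev chi f].

Definition dOmega : set Jhat := closure maximal_characters.

(* chi(s^-1 . s) *)
Definition pull (s : Il C) (chi : {ptws J C -> bool}) : {ptws J C -> bool} :=
  fun e => chi (Iconj (Iinv s) e).

Lemma Jext (e f : J C) : \val e = \val f -> e = f.
Proof. exact: val_inj. Qed.

Lemma Jhat_ext (chi psi : Jhat) : ev chi =1 ev psi -> chi = psi.
Proof. by move=> h; apply: val_inj; apply/funext. Qed.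

Lemma ev_cap (chi : Jhat) e f : ev chi (Jcap e f) = ev chi e && ev chi f.
Proof. by have [_ + _] := set_valP chi; apply. Qed.

Lemma ev_empty (chi : Jhat) e : \val e = set0 -> ev chi e = false.
Proof. by have [_ _ +] := set_valP chi; apply. Qed.

Lemma ev_neq0 (chi : Jhat) e : ev chi e -> \val e !=set0.
Proof.
by move=> he; apply/set0P/eqP => e0; move: he; rewrite ev_empty.
Qed.

Lemma ev_ex (chi : Jhat) : exists e, ev chi e.
Proof. by have [+ _ _] := set_valP chi. Qed.

Lemma ev_sub (chi : Jhat) (e f : J C) :
  \val e `<=` \val f -> ev chi e -> ev chi f.
Proof.
move=> ef he; have : ev chi (Jcap e f); last by rewrite ev_cap => /andP[].
by rewrite (_ : Jcap e f = e) //; apply: Jext; exact/setIidPl.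
Qed.

Lemma IinvK (s : Il C) : Iinv (Iinv s) = s.
Proof. by apply: val_inj; exact: pinvK. Qed.

Lemma Iconj_inv_dom (s : Il C) : Iconj (Iinv s) (Idom (Iinv s)) = Idom s.
Proof.
apply: Jext; apply/seteqP; split=> x /=.
  by move=> [y _ ?]; exists y.
by move=> [y ?]; exists y => //; exists x.
Qed.

Lemma Iconj_cap (s : Il C) e f :
  Iconj s (Jcap e f) = Jcap (Iconj s e) (Iconj s f).
Proof.
apply: Jext; apply/seteqP; split=> y /=.
  by move=> [x [? ?] ?]; split; exists x.
move=> [[x ex xy] [x' fx' x'y]].
have xx' : x = x' := (Il_bij (set_valP s)).2 _ _ _ xy x'y.
by exists x => //; split=> //; rewrite xx'.
Qed.

Lemma IconjK (s : Il C) e : Iconj (Iinv s) (Iconj s e) = Jcap e (Idom s).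
Proof.
apply: Jext; apply/seteqP; split=> x /=.
  move=> [y [x' ex' x'y] xy].
  have -> : x = x' := (Il_bij (set_valP s)).2 _ _ _ xy x'y.
  by split=> //; exists y.
by move=> [ex [y xy]]; exists y => //; exists x.
Qed.

Lemma Iconj_comp (s t : Il C) e : Iconj (Icomp s t) e = Iconj s (Iconj t e).
Proof.
apply: Jext; apply/seteqP; split=> z /=.
  by move=> [x ex [y ? ?]]; exists y => //; exists x.
by move=> [y [x ? ?] ?]; exists x => //; exists y.
Qed.

Lemma Iinv_comp (s t : Il C) : Iinv (Icomp s t) = Icomp (Iinv t) (Iinv s).
Proof.
by apply: val_inj; apply/seteqP; split=> -[x y] /= [z ? ?]; exists z.
Qed.

Lemma Idom_comp (s t : Il C) : Idom (Icomp s t) = Iconj (Iinv t) (Idom s).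
Proof.
apply: Jext; apply/seteqP; split=> x /=.
  by move=> [z [y ? ?]]; exists y => //; exists z.
by move=> [y [z ?] ?]; exists z, y.
Qed.

Lemma pull_character (s : Il C) (chi : Jhat) :
  ev chi (Idom s) -> is_character (pull s (\val chi)).
Proof.
move=> hs; split.
- by exists (Idom (Iinv s)); rewrite /pull Iconj_inv_dom.
- by move=> e f; rewrite /pull Iconj_cap; exact: ev_cap.
- move=> e e0; apply: ev_empty; apply/seteqP; split=> // x [y /=].
  by rewrite e0.
Qed.

(* s.chi, for chi(s^-1 s) = 1 *)
Definition jact (s : Il C) (chi : Jhat) (h : ev chi (Idom s)) : Jhat :=
  SigSub (mem_set (pull_character h)).

Lemma jactE s chi (h : ev chi (Idom s)) e :
  ev (jact h) e = ev chi (Iconj (Iinv s) e).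
Proof. by []. Qed.

Lemma pull_continuous s : continuous (pull s).
Proof.
move=> chi; apply/cvg_sup => e; move: chi.
apply: (@continuous_comp_initial _ _ _ (fun f : J C -> bool => f e)).
exact: (@proj_continuous (J C) (fun=> bool) (Iconj (Iinv s) e)).
Qed.

Lemma val_cts : continuous (\val : Jhat -> {ptws J C -> bool}).
Proof. exact: initial_continuous. Qed.

Lemma near_ev (chi : Jhat) e b : ev chi e = b -> \forall psi \near chi, ev psi e = b.
Proof.
move=> h; have he : continuous ((@proj (J C) (fun=> bool) e : {ptws J C -> bool} -> bool) \o (\val : Jhat -> {ptws J C -> bool})).
  move=> x; apply: continuous_comp; first exact: val_cts.
  exact: proj_continuous.
by apply: (he chi [set c | c = b]); rewrite nbhs_principalE; apply/principal_filterP.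
Qed.

Lemma near_jact s chi (h : ev chi (Idom s)) (B : set Jhat) : nbhs (jact h) B ->
  \forall psi \near chi, forall h' : ev psi (Idom s), B (jact h').
Proof.
move=> [_ [[V oV <-] /= Vh] VB].
have pc : continuous (pull s \o (\val : Jhat -> {ptws J C -> bool})).
  by move=> x; apply: continuous_comp; [exact: val_cts|exact: pull_continuous].
have nV : nbhs (pull s (\val chi)) V by exact: open_nbhs_nbhs.
have nV' : nbhs chi ((pull s \o (\val : Jhat -> {ptws J C -> bool})) @^-1` V).
  exact: pc.
apply: filterS nV' => psi Vpsi h'.
exact: VB.
Qed.

Lemma jact_invP s chi (h : ev chi (Idom s)) : ev (jact h) (Idom (Iinv s)).
Proof. by rewrite jactE Iconj_inv_dom. Qed.

Lemma jactK s chi (h : ev chi (Idom s)) (h' : ev (jact h) (Idom (Iinv s))) :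
  jact h' = chi.
Proof.
by apply: Jhat_ext => e; rewrite !jactE IinvK IconjK ev_cap h andbT.
Qed.

Lemma jact_max s chi (h : ev chi (Idom s)) :
  maximal_characters chi -> maximal_characters (jact h).
Proof.
move=> mx psi le; apply/seteqP; split=> // e /= he.
have hp : ev psi (Idom (Iinv s)) by apply: le; exact: jact_invP.
have : [set e | ev chi e] `<=` [set e | ev (jact hp) e].
  move=> f /= hf; rewrite jactE; apply: le; rewrite /= jactE IinvK IconjK.
  by rewrite ev_cap hf h.
move=> /mx /seteqP[+ _] => /(_ (Iconj (Iinv s) e)); apply.
have ess : Iconj (Iinv (Iinv s)) (Iconj (Iinv s) e) = Jcap e (Idom (Iinv s)).
  exact: IconjK.
by rewrite /= jactE ess ev_cap he hp.
Qed.

Lemma jact_dOmega s chi (h : ev chi (Idom s)) : dOmega chi -> dOmega (jact h).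
Proof.
move=> cl B nB.
have /cl [psi [mpsi [hs hB]]] : nbhs chi [set psi : Jhat |
    ev psi (Idom s) = true /\ forall h' : ev psi (Idom s), B (jact h')].
  by apply: filterI; [exact: near_ev|exact: near_jact].
by exists (jact hs); split; [exact: jact_max|exact: hB].
Qed.

Lemma maximal_disjoint (chi : Jhat) e : maximal_characters chi ->
  ev chi e = false -> exists2 f, ev chi f & \val f `&` \val e = set0.
Proof.
move=> mx he; apply: contrapT => no.
have meet f : ev chi f -> \val f `&` \val e !=set0.
  by move=> hf; apply/set0P/eqP => fe0; apply: no; exists f.
pose psi : {ptws J C -> bool} :=
  fun g => `[< exists2 f, ev chi f & \val f `&` \val e `<=` \val g >].
have cpsi : is_character psi.
  split.
  - have [f hf] := ev_ex chi.
    by exists f; apply/asboolP; exists f => // x [].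
  - move=> g1 g2; apply/asboolP/andP.
      move=> [f hf fe]; split; apply/asboolP; exists f => // x /fe; by case.
    move=> [/asboolP[f1 h1 s1] /asboolP[f2 h2 s2]].
    exists (Jcap f1 f2); first by rewrite ev_cap h1.
    by move=> x [[f1x f2x] ex]; split; [exact: s1|exact: s2].
  - move=> g g0; apply/asboolP => -[f hf]; rewrite g0 => fe0.
    by have [x /fe0] := meet _ hf.
have /seteqP[+ _] : [set g | ev (SigSub (mem_set cpsi) : Jhat) g] = [set g | ev chi g].
  by apply: mx => f hf; apply/asboolP; exists f => // x [].
have [f hf] := ev_ex chi.
move=> /(_ e); rewrite /= he => H; suff: false by []; apply: H.
by apply/asboolP; exists f => // x [].
Qed.


Lemma maximal_Omega : maximal_characters `<=` Omega.
Proof.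
move=> chi mx e fs eU he; apply: contrapT => no.
have [g hg gfs] : exists2 g, ev chi g &
    forall f, f \in fs -> \val g `&` \val f = set0.
  have {no eU} : forall f, f \in fs -> ev chi f = false.
    by move=> f ffs; apply/negP => hf; apply: no; exists f.
  elim: fs => [_|f fs IH no]; first by have [g hg] := ev_ex chi; exists g.
  have [g hg gf] : exists2 g, ev chi g & \val g `&` \val f = set0.
    by apply: maximal_disjoint => //; apply: no; rewrite mem_head.
  have [k lfs|g' hg' gfs] := IH.
    by apply: no; rewrite in_cons lfs orbT.
  exists (Jcap g g'); first by rewrite ev_cap hg.
  move=> k; rewrite in_cons => /orP[/eqP->|/gfs k0].
    by rewrite /= setIAC gf set0I.
  by rewrite /= -setIA k0 setI0.
have : ev chi (Jcap g e) by rewrite ev_cap hg.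
rewrite ev_empty //= eU setI_bigcupr; apply/seteqP; split=> // x [f /= /gfs gf0].
by move=> h; have : (\val g `&` \val f) x by []; rewrite gf0.
Qed.

Lemma dOmega_Omega : dOmega `<=` Omega.
Proof.
move=> chi cl e fs eU he; apply: contrapT => no.
have : nbhs chi [set psi : Jhat | ev psi e = true /\
    forall f, f \in fs -> ev psi f = false].
  apply: filterI; first exact: near_ev.
  have {no eU} : forall f, f \in fs -> ev chi f = false.
    by move=> f ffs; apply/negP => hf; apply: no; exists f.
  elim: fs => [_|f fs IH hfs]; first by apply: filterS filterT.
  have hf : ev chi f = false by apply: hfs; rewrite mem_head.
  apply: filterS2 (near_ev hf) (IH _) => [psi h1 h2 k|k kfs].
    by rewrite in_cons => /orP[/eqP->|/h2].
  by apply: hfs; rewrite in_cons kfs orbT.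
move=> /cl[psi [/maximal_Omega /(_ e fs eU) om [pe pfs]]].
by have [f /pfs ->] := om pe.
Qed.

End Characters.

(* ** Etale groupoids *)
(* [product g h] is meaningful only when [source g = range h]. *)
Record etaleGroupoid := EtaleGroupoid {
  arrows : topologicalType ;
  units : topologicalType ;
  source : arrows -> units ;
  target : arrows -> units ;
  identity : units -> arrows ;
  inverse : arrows -> arrows ;
  product : arrows -> arrows -> arrows ;
  source_identity : forall x, source (identity x) = x ;
  target_identity : forall x, target (identity x) = x ;
  source_inverse : forall g, source (inverse g) = target g ;
  target_inverse : forall g, target (inverse g) = source g ;
  source_product : forall g h, source g = target h ->
    source (product g h) = source h ;
  target_product : forall g h, source g = target h ->
    target (product g h) = target g ;
  productA : forall g h k, source g = target h -> source h = target k ->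
    product g (product h k) = product (product g h) k ;
  product_identity : forall g, product g (identity (source g)) = g ;
  identity_product : forall g, product (identity (target g)) g = g ;
  product_inverse : forall g, product g (inverse g) = identity (target g) ;
  inverse_product : forall g, product (inverse g) g = identity (source g) ;
  inverse_continuous : continuous inverse ;
  product_continuous :
    {within [set gh : arrows * arrows | source gh.1 = target gh.2],
      continuous (fun gh => product gh.1 gh.2)} ;
  target_continuous : continuous target ;
  (* the source map is a local homeomorphism *)
  source_continuous : continuous source ;
  source_open : forall U, open U -> open (source @` U) ;
  source_locally_injective : forall g, exists U : set arrows,
    [/\ open U, U g & {in U &, injective source}]
}.

Definition invariant (G : etaleGroupoid) (A : set (units G)) :=
  forall g : arrows G, A (source g) <-> A (target g).

Definition minimal (G : etaleGroupoid) :=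
  forall A : set (units G), closed A -> invariant A -> A = set0 \/ A = setT.

Section Germs.
Variable C : lcCategory.

Definition bdry : topologicalType := @dOmega C.

Definition xev (chi : bdry) (e : J C) : bool := ev (\val chi) e.

Definition xact (s : Il C) (chi : bdry) (h : xev chi (Idom s)) : bdry :=
  SigSub (mem_set (@jact_dOmega _ _ _ h (set_valP chi))).

Lemma bdry_ext (chi psi : bdry) : xev chi =1 xev psi -> chi = psi.
Proof. by move=> h; apply: val_inj; apply: Jhat_ext. Qed.

Lemma xactE s chi (h : xev chi (Idom s)) e :
  xev (xact h) e = xev chi (Iconj (Iinv s) e).
Proof. by []. Qed.

Lemma near_sub (chi : bdry) (P : set (@Jhat C)) :
  nbhs (\val chi) P -> \forall psi \near chi, P (\val psi).
Proof. by move=> nP; have := @initial_continuous _ _ (\val : bdry -> Jhat C) chi P nP. Qed.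

Lemma near_xev (chi : bdry) e b :
  xev chi e = b -> \forall psi \near chi, xev psi e = b.
Proof. by move=> h; exact: (near_sub (near_ev h)). Qed.

Lemma near_xact s chi (h : xev chi (Idom s)) (B : set bdry) : nbhs (xact h) B ->
  \forall psi \near chi, forall h' : xev psi (Idom s), B (xact h').
Proof.
move=> [_ [[V oV <-] /= Vh] VB].
have nV : nbhs (@jact _ _ _ h) V by exact: open_nbhs_nbhs.
have nP := near_sub (near_jact nV); apply: filterS nP => psi Vpsi h'.
by apply: VB; exact: Vpsi.
Qed.

(* For each chi, [gb chi] is the collection of sets A such that s A = t A      *)
(* identifies (s, chi) and (t, chi). The two instances are [base_J] and        *)
(* [base_Jbar]; the axioms are what the groupoid structure requires.           *)
Record germ_base := GermBase {
  gb :> bdry -> set (set C) ;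
  gb_J : forall chi e, xev chi e -> gb chi (\val e) ;
  gb_capI : forall chi A B, gb chi A -> gb chi B -> gb chi (A `&` B) ;
  gb_pull : forall s chi (h : xev chi (Idom s)) A,
    gb (xact h) A -> gb chi (pimg (pinv (\val s)) A) ;
  gb_det : forall chi A e f, gb chi A -> A `&` \val e `<=` \val f ->
    xev chi e -> xev chi f ;
  gb_near : forall chi A, gb chi A -> \forall psi \near chi, gb psi A
}.

Definition gpair := {p : Il C * bdry | xev p.2 (Idom p.1)}.

Definition gpair_act (p : gpair) : bdry := xact (valP p).

Definition mkgpair (s : Il C) (chi : bdry) (h : xev chi (Idom s)) : gpair :=
  exist _ (s, chi) h.

Lemma gpair_actE s chi (h : xev chi (Idom s)) : gpair_act (mkgpair h) = xact h.
Proof. by rewrite /gpair_act; congr xact; exact: bool_irrelevance. Qed.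

Lemma gpair_ext (p q : gpair) : (\val p).1 = (\val q).1 ->
  (\val p).2 = (\val q).2 -> p = q.
Proof.
by move=> e1 e2; apply: val_inj; rewrite [LHS]surjective_pairing e1 e2 -surjective_pairing.
Qed.

Section GermGroupoid.
Variable T : germ_base.
Implicit Types p q r : gpair.

Definition same_germ p q : bool :=
  `[< (\val p).2 = (\val q).2 /\ exists2 A, T (\val p).2 A &
      prestr (\val (\val p).1) A = prestr (\val (\val q).1) A >].

Lemma same_germ_refl : reflexive same_germ.
Proof.
move=> p; apply/asboolP; split=> //.
by exists (\val (Idom (\val p).1)) => //; apply: gb_J; exact: (valP p).
Qed.

Lemma same_germ_sym : symmetric same_germ.
Proof.
suff h p q : same_germ p q -> same_germ q p by move=> p q; apply/idP/idP; exact: h.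
move=> /asboolP[pq [A TA e]]; apply/asboolP; split=> //; exists A => //.
by rewrite -pq.
Qed.

Lemma same_germ_trans : transitive same_germ.
Proof.
move=> q p r /asboolP[pq [A TA /prestrP sA]] /asboolP[qr [B TB /prestrP sB]].
apply/asboolP; split; first by rewrite pq.
exists (A `&` B); first by apply: gb_capI => //; rewrite pq.
apply/prestrP => x y [Ax Bx]; split.
  by move=> /(sA x y Ax)/(sB x y Bx).
by move=> /(sB x y Bx)/(sA x y Ax).
Qed.

Canonical same_germ_equiv :=
  EquivRel same_germ same_germ_refl same_germ_sym same_germ_trans.

Definition germ := {eq_quot same_germ_equiv}.

HB.instance Definition _ := Choice.on germ.

Definition germ_of p : germ := \pi_({eq_quot same_germ_equiv})%qT p.

Definition germ_repr (g : germ) : gpair := repr (g : {eq_quot same_germ_equiv}).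

Lemma germ_reprK g : germ_of (germ_repr g) = g.
Proof. exact: reprK. Qed.

Lemma germP p q : reflect (germ_of p = germ_of q) (same_germ p q).
Proof. exact: eqmodP. Qed.

Lemma germ_ind (P : germ -> Prop) : (forall p, P (germ_of p)) -> forall g, P g.
Proof. by move=> h g; rewrite -(germ_reprK g). Qed.

Lemma germ_repr_of p : same_germ (germ_repr (germ_of p)) p.
Proof. by apply/germP; rewrite germ_reprK. Qed.

(* The sets [s, U] of classes of the pairs (s, psi) with psi in U, for U open *)
(* in the domain of s, form a basis of this topology.                         *)
Definition germ_open (O : set germ) :=
  forall (s : Il C) (chi : bdry) (h : xev chi (Idom s)), O (germ_of (mkgpair h)) ->
    \forall psi \near chi,
      forall h' : xev psi (Idom s), O (germ_of (mkgpair h')).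

Lemma germ_openT : germ_open setT.
Proof. by move=> s chi h _; apply: filterS filterT. Qed.

Lemma germ_openI : setI_closed germ_open.
Proof.
move=> O1 O2 o1 o2 s chi h [O1h O2h].
by apply: filterS2 (o1 _ _ _ O1h) (o2 _ _ _ O2h) => psi h1 h2 h'; split.
Qed.

Lemma germ_open_bigU (I : Type) (O : I -> set germ) :
  (forall i, germ_open (O i)) -> germ_open (\bigcup_i O i).
Proof.
move=> o s chi h [i _ Oi]; apply: filterS (o i _ _ _ Oi) => psi h1 h'.
by exists i.
Qed.

HB.instance Definition _ :=
  isOpenTopological.Build germ germ_openT germ_openI germ_open_bigU.

Lemma germ_openE (O : set germ) : open O = germ_open O.
Proof. by []. Qed.
Lemma pair_comp_subproof p q : (\val p).2 = gpair_act q ->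
  xev (\val q).2 (Idom (Icomp (\val p).1 (\val q).1)).
Proof.
by move=> e; have := valP p; rewrite e /gpair_act xactE Idom_comp.
Qed.

(* (s, t.chi)(t, chi) = (s t, chi) *)
Definition pair_comp p q : gpair :=
  if pselect ((\val p).2 = gpair_act q) is left e
  then mkgpair (pair_comp_subproof e) else p.

(* (s, chi)^-1 = (s^-1, s.chi) *)
Definition pair_inv p : gpair := @mkgpair (Iinv (\val p).1) (gpair_act p) (jact_invP (valP p)).

Lemma idempotent_subproof (e : J C) :
  exists s : Il C, \val s = [set p | p.1 = p.2 /\ \val e p.1].
Proof.
have [s hs es] := set_valP e.
exists (SigSub (mem_set (Il_comp (Il_inv hs) hs))).
have [_ si] := Il_bij hs.
apply/seteqP; split=> -[x y]; rewrite /= -es.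
  by move=> [z h1 h2]; split; [exact: si h1 h2|exists z].
by move=> [<- [z h]]; exists z.
Qed.

Lemma pair_id_subproof (chi : bdry) : exists s : Il C,
  xev chi (Idom s) /\ forall x y, \val s (x, y) -> x = y.
Proof.
have [e he] := ev_ex (\val chi); have [s hs] := idempotent_subproof e.
exists s; split; last by move=> x y; rewrite hs => -[].
by apply: ev_sub he => x ex; exists x; rewrite hs.
Qed.

(* (e, chi), for some idempotent e of I_l with chi(e) = 1 *)
Definition pair_id (chi : bdry) : gpair :=
  mkgpair (proj1 (svalP (cid (pair_id_subproof chi)))).

Lemma pair_idE chi x y : \val (\val (pair_id chi)).1 (x, y) -> x = y.
Proof. by have [_ +] := svalP (cid (pair_id_subproof chi)); apply. Qed.

Definition germ_source (g : germ) : bdry := (\val (germ_repr g)).2.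
Definition germ_target (g : germ) : bdry := gpair_act (germ_repr g).
Definition germ_id (chi : bdry) : germ := germ_of (pair_id chi).
Definition germ_inv (g : germ) : germ := germ_of (pair_inv (germ_repr g)).
Definition germ_comp (g h : germ) : germ :=
  germ_of (pair_comp (germ_repr g) (germ_repr h)).

Lemma same_germ_act p q : same_germ p q -> gpair_act p = gpair_act q.
Proof.
suff H p' q' : same_germ p' q' -> forall e, xev (gpair_act p') e -> xev (gpair_act q') e.
  move=> pq; apply: bdry_ext => e; apply/idP/idP; apply: H => //.
  by rewrite same_germ_sym.
case: p' q' => [[s chi] hs] [[t psi] ht] /asboolP[/= e [A TA /prestrP sA]] f.
subst psi; rewrite !xactE /=; apply: (gb_det TA) => x [Ax /=].
by move=> [y fy sxy]; exists y => //; exact/(sA x y Ax).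
Qed.

Lemma germ_sourceE p : germ_source (germ_of p) = (\val p).2.
Proof. by have /asboolP[] := germ_repr_of p. Qed.

Lemma germ_targetE p : germ_target (germ_of p) = gpair_act p.
Proof. exact: same_germ_act (germ_repr_of p). Qed.

Lemma same_germ_inv p q : same_germ p q -> same_germ (pair_inv p) (pair_inv q).
Proof.
move=> pq; apply/asboolP; split; first exact: same_germ_act.
case: p q pq => [[s chi] hs] [[t psi] ht] /asboolP[/= e [A TA /prestrP sA]].
subst psi; exists (pimg (\val s) A).
  have h' : xev (gpair_act (exist _ (s, chi) hs)) (Idom (Iinv s)) by exact: jact_invP.
  have := @gb_pull T (Iinv s) _ h' A; rewrite /= pinvK; apply.
  by rewrite (_ : xact h' = chi) //; apply: val_inj; exact: jactK.
have [_ si] := Il_bij (set_valP s); have [_ ti] := Il_bij (set_valP t).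
apply/prestrP => y x [z Az szy]; have tzy := (sA _ _ Az).1 szy; split=> h.
  have <- : z = x by exact: si szy h.
  exact: tzy.
have <- : z = x by exact: ti tzy h.
exact: szy.
Qed.

Lemma germ_invE p : germ_inv (germ_of p) = germ_of (pair_inv p).
Proof. by apply/germP/same_germ_inv; exact: germ_repr_of. Qed.

Lemma pair_compE p q (h : (\val p).2 = gpair_act q) :
  pair_comp p q = mkgpair (pair_comp_subproof h).
Proof.
by rewrite /pair_comp; case: pselect => // h'; apply: gpair_ext.
Qed.

Lemma same_germ_comp p p' q q' : (\val p).2 = gpair_act q ->
  same_germ p p' -> same_germ q q' ->
  same_germ (pair_comp p q) (pair_comp p' q').
Proof.
move=> h pp qq.
have h' : (\val p').2 = gpair_act q'.
  by rewrite -(same_germ_act qq) -h; have /asboolP[] := pp.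
rewrite (pair_compE h) (pair_compE h').
move: pp qq => /asboolP[ep [A TA /prestrP sA]] /asboolP[eq [B TB /prestrP sB]].
apply/asboolP; split=> //.
exists (B `&` pimg (pinv (\val (\val q).1)) A).
  by apply: gb_capI => //; apply: (gb_pull (h := valP q)); rewrite -[xact _]h.
have [tf _] := Il_bij (set_valP (\val q).1).
apply/prestrP => x z [Bx [y Ay txy]]; split=> -[y' /= h1 h2].
  have ? := tf _ _ _ h1 txy; subst y'.
  by exists y; [exact/(sB _ _ Bx)|exact/(sA _ _ Ay)].
have h3 := (sB _ _ Bx).2 h1.
have ? := tf _ _ _ h3 txy; subst y'.
by exists y => //; exact/(sA _ _ Ay).
Qed.

Lemma germ_compE p q : (\val p).2 = gpair_act q ->
  germ_comp (germ_of p) (germ_of q) = germ_of (pair_comp p q).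
Proof.
move=> h; apply/germP/same_germ_comp; try exact: germ_repr_of.
by rewrite -[LHS]germ_sourceE germ_reprK germ_sourceE h -germ_targetE.
Qed.

Lemma pair_comp_act p q : (\val p).2 = gpair_act q ->
  gpair_act (pair_comp p q) = gpair_act p.
Proof.
move=> h; rewrite (pair_compE h); apply: bdry_ext => e.
by rewrite !xactE /= h xactE Iinv_comp Iconj_comp.
Qed.

Lemma pair_id_act chi : gpair_act (pair_id chi) = chi.
Proof.
apply: bdry_ext => e; rewrite xactE.
have hs := valP (pair_id chi).
apply/idP/idP; first by apply: ev_sub => x [y ey /pair_idE /= ->].
move=> he; have : xev chi (Jcap e (Idom (\val (pair_id chi)).1)).
  by rewrite /xev ev_cap; apply/andP; split.
apply: ev_sub => x [ex [y sxy]]; exists x => //.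
by have := sxy; rewrite -(pair_idE sxy).
Qed.

Lemma germ_source_id chi : germ_source (germ_id chi) = chi.
Proof. by rewrite germ_sourceE. Qed.

Lemma germ_target_id chi : germ_target (germ_id chi) = chi.
Proof. by rewrite germ_targetE pair_id_act. Qed.

Lemma germ_source_inv g : germ_source (germ_inv g) = germ_target g.
Proof. by elim/germ_ind: g => p; rewrite germ_invE germ_sourceE germ_targetE. Qed.

Lemma pair_inv_act p : gpair_act (pair_inv p) = (\val p).2.
Proof. by apply: val_inj; exact: jactK. Qed.

Lemma germ_target_inv g : germ_target (germ_inv g) = germ_source g.
Proof.
elim/germ_ind: g => p; rewrite germ_invE germ_sourceE germ_targetE.
exact: pair_inv_act.
Qed.

Lemma germ_source_comp g h : germ_source g = germ_target h ->
  germ_source (germ_comp g h) = germ_source h.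
Proof.
elim/germ_ind: g => p; elim/germ_ind: h => q.
move=> e; have {}e : (\val p).2 = gpair_act q.
  by rewrite -germ_sourceE -germ_targetE.
by rewrite germ_compE // !germ_sourceE (pair_compE e).
Qed.

Lemma germ_target_comp g h : germ_source g = germ_target h ->
  germ_target (germ_comp g h) = germ_target g.
Proof.
elim/germ_ind: g => p; elim/germ_ind: h => q.
move=> e; have {}e : (\val p).2 = gpair_act q.
  by rewrite -germ_sourceE -germ_targetE.
by rewrite germ_compE // !germ_targetE pair_comp_act.
Qed.

Lemma germ_compA g h k :
  germ_source g = germ_target h -> germ_source h = germ_target k ->
  germ_comp g (germ_comp h k) = germ_comp (germ_comp g h) k.
Proof.
elim/germ_ind: g => p; elim/germ_ind: h => q; elim/germ_ind: k => r.
rewrite !germ_targetE !germ_sourceE => pq qr.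
have p_qr : (\val p).2 = gpair_act (pair_comp q r) by rewrite pair_comp_act.
have pq_r : (\val (pair_comp p q)).2 = gpair_act r by rewrite (pair_compE pq).
rewrite !germ_compE // (pair_compE p_qr) (pair_compE pq_r).
congr germ_of; apply: gpair_ext; last by rewrite /= (pair_compE qr).
rewrite /= (pair_compE pq) (pair_compE qr) /=; apply: val_inj.
apply/seteqP; split=> -[x z] /=.
  by move=> [y [w ? ?] ?]; exists w => //; exists y.
by move=> [w ? [y ? ?]]; exists y => //; exists w.
Qed.

Lemma germ_eq p q : (\val p).2 = (\val q).2 ->
  (exists2 e : J C, xev (\val p).2 e & forall x y, \val e x ->
     \val (\val p).1 (x, y) <-> \val (\val q).1 (x, y)) ->
  germ_of p = germ_of q.
Proof.
move=> e [f hf pq]; apply/germP/asboolP; split=> //.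
by exists (\val f); [exact: gb_J|apply/prestrP].
Qed.

Lemma pair_id_dom chi x :
  \val (Idom (\val (pair_id chi)).1) x <-> \val (\val (pair_id chi)).1 (x, x).
Proof.
split=> [[y h]|h]; last by exists x.
by have := h; rewrite -(pair_idE h).
Qed.

Lemma germ_comp_id g : germ_comp g (germ_id (germ_source g)) = g.
Proof.
elim/germ_ind: g => p; rewrite germ_sourceE.
have h : (\val p).2 = gpair_act (pair_id (\val p).2) by rewrite pair_id_act.
rewrite germ_compE // (pair_compE h); apply: germ_eq => //=.
exists (Idom (\val (pair_id (\val p).2)).1); first exact: (valP (pair_id _)).
move=> x y /pair_id_dom xx; split; last by move=> xy; exists x.
by move=> [z /= /pair_idE ->].
Qed.

Lemma germ_id_comp g : germ_comp (germ_id (germ_target g)) g = g.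
Proof.
elim/germ_ind: g => p; rewrite germ_targetE.
have h : (\val (pair_id (gpair_act p))).2 = gpair_act p by [].
rewrite germ_compE // (pair_compE h); apply: germ_eq => //=.
exists (Idom (Icomp (\val (pair_id (gpair_act p))).1 (\val p).1)).
  exact: (pair_comp_subproof h).
move=> x y [z [w /= xw wz]]; split; first by move=> [u /= + /pair_idE <-].
move=> xy; exists y => //=.
have [pf _] := Il_bij (set_valP (\val p).1).
rewrite -(pf _ _ _ xw xy); apply/pair_id_dom; by exists z.
Qed.

Lemma germ_comp_inv g : germ_comp g (germ_inv g) = germ_id (germ_target g).
Proof.
elim/germ_ind: g => p; rewrite germ_targetE germ_invE.
have h : (\val p).2 = gpair_act (pair_inv p) by rewrite pair_inv_act.
rewrite germ_compE // (pair_compE h); apply: germ_eq => //=.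
exists (Jcap (Idom (Iinv (\val p).1)) (Idom (\val (pair_id (gpair_act p))).1)).
  rewrite /xev ev_cap; apply/andP; split; first exact: (valP (pair_inv p)).
  exact: (valP (pair_id (gpair_act p))).
have [pf _] := Il_bij (set_valP (\val p).1).
move=> y z [[x xy] /pair_id_dom yy]; split.
  by move=> [x' /= x'y x'z]; rewrite -(pf _ _ _ x'y x'z).
by move=> /pair_idE <-; exists x.
Qed.

Lemma germ_inv_comp g : germ_comp (germ_inv g) g = germ_id (germ_source g).
Proof.
elim/germ_ind: g => p; rewrite germ_sourceE germ_invE.
have h : (\val (pair_inv p)).2 = gpair_act p by [].
rewrite germ_compE // (pair_compE h); apply: germ_eq => //=.
exists (Jcap (Idom (\val p).1) (Idom (\val (pair_id (\val p).2)).1)).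
  rewrite /xev ev_cap; apply/andP; split; first exact: (valP p).
  exact: (valP (pair_id (\val p).2)).
have [_ pi] := Il_bij (set_valP (\val p).1).
move=> x z [[y xy] /pair_id_dom xx]; split.
  by move=> [y' /= xy' zy']; have <- : x = z := pi _ _ _ xy' zy'.
by move=> /pair_idE <-; exists y.
Qed.

Lemma germ_bisection_open (s : Il C) (W : set bdry) : open W ->
  open [set g : germ | exists chi (h : xev chi (Idom s)),
    W chi /\ g = germ_of (mkgpair h)].
Proof.
move=> oW; rewrite germ_openE => t chi ht [psi [hs [Wpsi]]] /germP/asboolP[/= e [A TA ts]].
have Wchi : W chi by rewrite e.
have nW : nbhs chi W by exact: open_nbhs_nbhs.
apply: filterS2 (gb_near TA) nW => xi Txi Wxi ht'.
have hs' : xev xi (Idom s).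
  apply: (gb_det Txi _ ht') => x [Ax [y ty]]; exists y.
  by move/prestrP: ts => /(_ x y Ax)[+ _]; apply.
exists xi, hs'; split=> //; apply/germP/asboolP; split=> //.
by exists A.
Qed.

Lemma germ_source_continuous : continuous germ_source.
Proof.
apply/continuousP => U oU; rewrite germ_openE => s chi h.
rewrite /preimage /= germ_sourceE /= => Uchi.
have nU : nbhs chi U by exact: open_nbhs_nbhs.
by apply: filterS nU => psi Upsi h'; rewrite germ_sourceE.
Qed.

Lemma germ_target_continuous : continuous germ_target.
Proof.
apply/continuousP => U oU; rewrite germ_openE => s chi h.
rewrite /preimage /= germ_targetE => Uchi.
have nU : nbhs (xact h) U.
  by apply: open_nbhs_nbhs; rewrite -gpair_actE; split.
have nP := near_xact nU; apply: filterS nP => psi Upsi h'.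
by rewrite germ_targetE gpair_actE.
Qed.

Lemma germ_inv_continuous : continuous germ_inv.
Proof.
apply/continuousP => O oO; rewrite germ_openE => s chi h.
rewrite /preimage /= germ_invE => Oh.
have := oO; rewrite germ_openE => /(_ _ _ _ Oh); rewrite gpair_actE => nO.
have nP := near_xact nO; apply: filterS nP => psi Opsi h'; rewrite germ_invE.
have := jact_invP h'; rewrite -[jact h']/(\val (xact h')) => h2.
have := Opsi h' h2; congr (O (germ_of _)).
by apply: gpair_ext => //=; rewrite gpair_actE.
Qed.

Lemma germ_source_open U : open U -> open (germ_source @` U).
Proof.
rewrite germ_openE => oU; rewrite openE => chi [g Ug <-] /=.
elim/germ_ind: g Ug => -[[s psi] h] Ug; rewrite germ_sourceE /interior /=.
apply: filterS2 (oU _ _ _ Ug) (near_xev h) => xi Uxi hxi.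
by exists (germ_of (mkgpair hxi)); rewrite ?germ_sourceE.
Qed.

Lemma germ_source_locally_injective g :
  exists U : set (germ), [/\ open U, U g & {in U &, injective germ_source}].
Proof.
elim/germ_ind: g => -[[s psi] h].
exists [set g : germ | exists chi (h : xev chi (Idom s)),
    setT chi /\ g = germ_of (mkgpair h)]; split.
- exact/germ_bisection_open/openT.
- by exists psi, h.
move=> g1 g2 /set_mem[chi1 [h1 [_ ->]]] /set_mem[chi2 [h2 [_ ->]]].
by rewrite !germ_sourceE /= => e; congr germ_of; apply: gpair_ext.
Qed.

Lemma nbhs_open (Y : topologicalType) (y : Y) (A : set Y) :
  nbhs y A -> exists2 B, open_nbhs y B & B `<=` A.
Proof. by rewrite nbhsE. Qed.

Lemma germ_comp_continuous :
  {within [set gh : germ * germ | germ_source gh.1 = germ_target gh.2],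
    continuous (fun gh => germ_comp gh.1 gh.2)}.
Proof.
apply/subspace_continuousP => -[g h] /= gh O nO.
have [O' [oO' O'gh] O'O] := nbhs_open nO; move=> {nO}.
elim/germ_ind: g gh O'gh => p; elim/germ_ind: h => q gh O'pq.
have e : (\val p).2 = gpair_act q by rewrite -germ_sourceE -germ_targetE.
have {}O'pq : O' (germ_of (mkgpair (pair_comp_subproof e))).
  by rewrite -pair_compE -germ_compE.
have := oO'; rewrite germ_openE => /(_ _ _ _ O'pq) nO'.
have [W [oW Wq] WO] := nbhs_open nO'.
pose U := [set g : germ | exists chi (h : xev chi (Idom (\val p).1)),
    setT chi /\ g = germ_of (mkgpair h)].
pose V := [set g : germ | exists chi (h : xev chi (Idom (\val q).1)),
    W chi /\ g = germ_of (mkgpair h)].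
exists (U, V).
  split=> /=; apply: open_nbhs_nbhs; split.
  - exact/germ_bisection_open/openT.
  - exists (\val p).2, (valP p); split=> //; congr germ_of; exact: gpair_ext.
  - exact: germ_bisection_open.
  - exists (\val q).2, (valP q); split=> //; congr germ_of; exact: gpair_ext.
move=> [g' h'] /= [[chi [hc [_ ->]]] [psi [hp [Wpsi ->]]]] e'; apply: O'O.
have {}e' : (\val (mkgpair hc)).2 = gpair_act (mkgpair hp).
  by rewrite -germ_sourceE -germ_targetE.
suff : O' (germ_comp (germ_of (mkgpair hc)) (germ_of (mkgpair hp))) by [].
by rewrite germ_compE // (pair_compE e'); exact: WO.
Qed.

Definition germ_groupoid : etaleGroupoid :=
  EtaleGroupoid germ_source_id germ_target_id germ_source_inv germ_target_inv
    germ_source_comp germ_target_comp germ_compA germ_comp_id germ_id_comp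
    germ_comp_inv germ_inv_comp germ_inv_continuous germ_comp_continuous
    germ_target_continuous germ_source_continuous germ_source_open
    germ_source_locally_injective.

End GermGroupoid.

(* ** The two groupoids *)

Definition germs_J (chi : bdry) : set (set C) :=
  [set A | exists2 e : J C, xev chi e & A = \val e].

Definition Jbar_presentation (eps : set C) (e : J C) (fs : seq (J C)) :=
  (forall f, f \in fs -> \val f `<=` \val e) /\
  eps = \val e `\` \bigcup_(f in [set` fs]) \val f.

(* chi(eps) = 1, for eps in Jbar; by [germs_JbarP] this does not depend on the *)
(* presentation of eps.                                                        *)
Definition germs_Jbar (chi : bdry) : set (set C) :=
  [set eps | exists (e : J C) (fs : seq (J C)),
    [/\ Jbar_presentation eps e fs, xev chi e & forall f, f \in fs -> xev chi f = false]].

Lemma bdry_Omega (chi : bdry) : Omega (\val chi).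
Proof. exact/dOmega_Omega/set_valP. Qed.

Lemma germs_Jbar_cover chi A e (gs : seq (J C)) : germs_Jbar chi A ->
  A `&` \val e `<=` \bigcup_(g in [set` gs]) \val g -> xev chi e ->
  exists2 g, g \in gs & xev chi g.
Proof.
move=> [e' [fs [[_ ->] he' hfs]]] sub he.
have hee : xev chi (Jcap e e') by rewrite /xev ev_cap; apply/andP.
have [|k /mapP[l]] := @bdry_Omega chi (Jcap e e')
    [seq Jcap (Jcap e e') k | k <- gs ++ fs] _ hee.
  apply/seteqP; split=> [x ee'x|x [k /mapP[l _ ->]] []//].
  have [[k kfs kx]|no] := pselect (exists2 k, k \in fs & \val k x).
    exists (Jcap (Jcap e e') k) => //=.
    by apply/mapP; exists k; rewrite // mem_cat kfs orbT.
  have [|k kgs kx] := sub x.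
    split; last exact: ee'x.1.
    by split; [exact: ee'x.2|move=> [k /= kfs kx]; apply: no; exists k].
  exists (Jcap (Jcap e e') k) => //=.
  by apply/mapP; exists k; rewrite // mem_cat (kgs : k \in gs).
rewrite mem_cat => /orP[lgs|lfs] -> /=; rewrite ev_cap => /andP[_] hl.
  by exists l.
by have := hfs l lfs; rewrite /xev hl.
Qed.

Lemma germs_JbarP (chi : bdry) eps e fs : Jbar_presentation eps e fs ->
  germs_Jbar chi eps <-> xev chi e /\ forall f, f \in fs -> xev chi f = false.
Proof.
move=> [se eE]; split; last by move=> [he hfs]; exists e, fs.
move=> heps; have := heps => -[e' [fs' [[_ eE'] he' hfs']]]; split.
  have [|k] := @germs_Jbar_cover _ _ _ [:: e] heps _ he'.
    by move=> x []; rewrite {1}eE => -[ex _] _; exists e => //=; rewrite mem_head.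
  by rewrite mem_seq1 => /eqP->.
move=> f ffs; apply/negP => hf.
have [x []|//] := @germs_Jbar_cover _ _ _ [::] heps _ hf.
by rewrite eE => -[_ no] fx; case: no; exists f.
Qed.

Lemma germs_J_capI chi A B :
  germs_J chi A -> germs_J chi B -> germs_J chi (A `&` B).
Proof.
move=> [e he ->] [f hf ->]; exists (Jcap e f) => //.
by rewrite /xev ev_cap; apply/andP.
Qed.

Lemma germs_J_pull s chi (h : xev chi (Idom s)) A :
  germs_J (xact h) A -> germs_J chi (pimg (pinv (\val s)) A).
Proof. by move=> [e he ->]; exists (Iconj (Iinv s) e). Qed.

Lemma germs_J_det chi A e f : germs_J chi A -> A `&` \val e `<=` \val f ->
  xev chi e -> xev chi f.
Proof.
move=> [g hg ->] sub he; have : xev chi (Jcap g e).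
  by rewrite /xev ev_cap; apply/andP.
exact: ev_sub.
Qed.

Lemma germs_J_near chi A : germs_J chi A -> \forall psi \near chi, germs_J psi A.
Proof. by move=> [e he ->]; apply: filterS (near_xev he) => psi; exists e. Qed.

Definition base_J : germ_base :=
  @GermBase germs_J (fun chi e h => ex_intro2 _ _ e h erefl)
    germs_J_capI germs_J_pull germs_J_det germs_J_near.

Lemma germs_Jbar_J (chi : bdry) e : xev chi e -> germs_Jbar chi (\val e).
Proof.
move=> he; exists e, [::]; split=> //; split=> //.
by apply/seteqP; split=> [x ex|x []//]; split=> // -[].
Qed.

Lemma germs_Jbar_capI chi A B :
  germs_Jbar chi A -> germs_Jbar chi B -> germs_Jbar chi (A `&` B).
Proof.
move=> [e [fs [[_ ->] he hfs]]] [e' [fs' [[_ ->] he' hfs']]].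
exists (Jcap e e'), [seq Jcap (Jcap e e') k | k <- fs ++ fs']; split.
- split; first by move=> f /mapP[k _ ->] x [].
  apply/seteqP; split=> x.
    move=> [[ex no] [e'x no']]; split=> // -[f /mapP[k]].
    by rewrite mem_cat => /orP[] kfs -> [_ kx]; [apply: no|apply: no']; exists k.
  move=> [[ex e'x] no]; split; split=> // -[k /= kfs kx]; apply: no;
    exists (Jcap (Jcap e e') k) => //; apply/mapP; exists k => //;
    by rewrite mem_cat kfs ?orbT.
- by rewrite /xev ev_cap; apply/andP.
- move=> f /mapP[k]; rewrite mem_cat => /orP[/hfs|/hfs'] hk ->;
  by rewrite /xev ev_cap; move: hk; rewrite /xev => ->; rewrite andbF.
Qed.

Lemma germs_Jbar_pull s chi (h : xev chi (Idom s)) A :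
  germs_Jbar (xact h) A -> germs_Jbar chi (pimg (pinv (\val s)) A).
Proof.
move=> [e [fs [[sub ->] he hfs]]].
exists (Iconj (Iinv s) e), [seq Iconj (Iinv s) f | f <- fs]; split=> //.
- split; first by move=> _ /mapP[f /sub fe ->] x [y /fe]; exists y.
  have [sf _] := Il_bij (set_valP s).
  apply/seteqP; split=> x.
    move=> [y [ey no] xy]; split; first by exists y.
    move=> [_ /mapP[f ffs ->] [y' fy' xy']]; apply: no; exists f => //.
    by have -> : y = y' := sf _ _ _ xy xy'.
  move=> [[y ey xy] no]; exists y => //; split=> // -[f /= ffs fy]; apply: no.
  by exists (Iconj (Iinv s) f); [apply/mapP; exists f|exists y].
- by move=> _ /mapP[f /hfs + ->].
Qed.

Lemma germs_Jbar_det chi A e f : germs_Jbar chi A -> A `&` \val e `<=` \val f ->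
  xev chi e -> xev chi f.
Proof.
move=> hA sub he; have [|k] := @germs_Jbar_cover _ _ _ [:: f] hA _ he.
  by move=> x /sub fx; exists f => //=; rewrite mem_head.
by rewrite mem_seq1 => /eqP->.
Qed.

Lemma germs_Jbar_near chi A :
  germs_Jbar chi A -> \forall psi \near chi, germs_Jbar psi A.
Proof.
move=> [e [fs [eA he hfs]]].
have nfs : \forall psi \near chi, forall f, f \in fs -> xev psi f = false.
  elim: fs hfs {eA} => [_|f fs IH hfs]; first by apply: filterS filterT.
  have hf : xev chi f = false by apply: hfs; rewrite mem_head.
  apply: filterS2 (near_xev hf) (IH _) => [psi h1 h2 k|k kfs].
    by rewrite in_cons => /orP[/eqP->|/h2].
  by apply: hfs; rewrite in_cons kfs orbT.
by apply: filterS2 (near_xev he) nfs => psi h1 h2; exists e, fs.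
Qed.

Definition base_Jbar : germ_base :=
  @GermBase germs_Jbar germs_Jbar_J germs_Jbar_capI germs_Jbar_pull
    germs_Jbar_det germs_Jbar_near.

End Germs.

Definition Il_groupoid (C : lcCategory) : etaleGroupoid := germ_groupoid (base_J C).

Definition Il_groupoid_bar (C : lcCategory) : etaleGroupoid :=
  germ_groupoid (base_Jbar C).

(* Main.v *)
Require Import Defs.
From mathcomp Require Import all_boot all_classical topology.

Local Open Scope classical_set_scope.

(** Invariance of a subset of the boundary only involves sources and ranges of
germs, so for either notion of germ it means stability under the partial action
of I_l ([minimal_germP]). Hence (i) and (ii) are the same condition
[minimal_action], and it remains to compare it with (iii).

Near a maximal character chi the sets of all psi with psi(f) = 1, where
chi(f) = 1, form a neighbourhood basis ([maximal_nbhs]), because any e with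
chi(e) = 0 is disjoint from some such f. As maximal characters are dense in the
boundary, an orbit is dense as soon as it meets every set psi(f) = 1 with f
non-empty; that the orbit of chi meets it means that chi(s f s^-1) = 1 for some
s ([covered_orbit], [covered_minimal]).

Suppose (iii), let chi(e) = 1 and let s_1, ..., s_n be given by (iii) for e and f.
If chi vanished on all s_i f s_i^-1, so would a nearby maximal character, hence
every character that is 1 at some fixed non-empty e' <= e; but e' meets some s_i f s_i^-1.

Conversely, if the action is minimal, the closed invariant set of the chi that
vanish on all s f s^-1 is empty, since it omits a maximal character that is 1
at f ([minimal_orbit]). If (iii) failed for e and f, then for every finite list of
the s there would be a maximal character that is 1 at e and vanishes on the
s f s^-1 of that list; a limit along an ultrafilter ([ultra_dOmega]) would then be
a boundary point vanishing on all of them ([minimal_covered]). *)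

(** * Convergence of characters and maximal characters *)

Section Characters.
Variable C : lcCategory.
Implicit Types (chi psi : Jhat C) (e f g : J C).

(** The topology of Jhat is that of pointwise convergence. *)
Lemma Jhat_cvg (G : set_system (Jhat C)) chi : Filter G ->
  (forall e, G [set psi | ev psi e = ev chi e]) -> G --> chi.
Proof.
move=> FG h B [_ [[V oV <-] /= Vchi] VB]; apply: filterS VB _.
have : nbhs (\val chi) V by exact: open_nbhs_nbhs.
have : (\val : Jhat C -> {ptws J C -> bool}) @ G --> \val chi.
  2: exact.
apply/cvg_sup => e W [_ [[U oU <-] /= Uchi] UW].
rewrite nbhs_filterE fmapE; apply: (@filterS _ G FG _ _ _ (h e)) => psi he.
by apply: UW; suff : U (ev psi e) by []; rewrite he.
Qed.

(** The neighbourhoods of a maximal character are generated by positive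
conditions only. *)
Lemma maximal_nbhs chi (B : set (Jhat C)) : maximal_characters chi ->
  nbhs chi B -> exists2 f, ev chi f & forall psi, ev psi f -> B psi.
Proof.
move=> mx; set G := filter_from [set f | ev chi f] (fun f => [set psi | ev psi f]).
have FG : Filter G.
  apply: filter_from_filter; first exact: ev_ex.
  move=> f g hf hg; exists (Jcap f g); first by rewrite /= ev_cap; apply/andP.
  by move=> psi /=; rewrite ev_cap => /andP.
move=> nB; have : G B; last by move=> [f hf sub]; exists f => // psi /sub.
apply: (@Jhat_cvg G) nB => e; case he: (ev chi e).
  by exists e => // psi.
have [f hf fe] := maximal_disjoint mx he; exists f => // psi hpf.
apply/negP => hpe; have : ev psi (Jcap f e) by rewrite ev_cap; apply/andP.
by rewrite ev_empty.
Qed.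

(** Compactness: an ultrafilter of maximal characters on which a fixed e is
eventually 1 converges pointwise to a point of the boundary. The condition on e
keeps the limit from being the zero map. *)
Lemma ultra_dOmega (G : set_system (Jhat C)) e : UltraFilter G ->
  G (@maximal_characters C) -> G [set psi | ev psi e] ->
  exists2 chi, dOmega chi & forall f, G [set psi | ev psi f = ev chi f].
Proof.
move=> UG Gmx Ge.
pose x : {ptws J C -> bool} := fun f => `[< G [set psi : Jhat C | ev psi f] >].
have cx : is_character x.
  split.
  - by exists e; apply/asboolP.
  - move=> f g; apply/asboolP/andP.
      by move=> h; split; apply/asboolP; apply: filterS h => psi /=;
        rewrite ev_cap => /andP[].
    move=> [/asboolP hf /asboolP hg]; apply: filterS2 hf hg => psi /= hf hg.
    by rewrite ev_cap hf hg.
  - move=> f f0; apply/asboolP => h.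
    by have [psi /=] := filter_ex h; rewrite ev_empty.
pose chi : Jhat C := SigSub (mem_set cx).
have hchi f : G [set psi | ev psi f = ev chi f].
  rewrite -[ev chi f]/(`[< G [set psi : Jhat C | ev psi f] >]).
  case: asboolP => // nf.
  have [//|] := in_ultra_setVsetC [set psi : Jhat C | ev psi f] UG.
  by apply: filterS => psi /negP/negbTE.
exists chi => // B nB; have GB : G B by exact: (Jhat_cvg G chi _ hchi).
exact: filter_ex (filterI Gmx GB).
Qed.

(** Every non-empty e in J lies in a maximal filter of non-empty elements of J. *)
Lemma exists_maximal e : \val e !=set0 ->
  exists2 chi, maximal_characters chi & ev chi e.
Proof.
move=> e0.
(* Zorn's lemma needs the union of the empty chain, so the empty family is
   allowed in P; e itself is added to a maximal family only afterwards. *)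
pose P (F : set (J C)) := [/\ forall f g, F f -> F g -> F (Jcap f g),
  forall f g, F f -> \val f `<=` \val g -> F g &
  forall f, F f -> \val f `&` \val e !=set0].
have [|M [[MI MS M0] Mmx]] := @Zorn_bigcup _ P.
  move=> FF FP tot; split.
  - move=> f g [F hF Ff] [F' hF' F'g].
    have [sub|sub] := tot _ _ hF hF'.
      by exists F' => //; have [+ _ _] := FP _ hF'; apply=> //; apply: sub.
    by exists F => //; have [+ _ _] := FP _ hF; apply=> //; apply: sub.
  - move=> f g [F hF Ff] fg; exists F => //.
    by have [_ + _] := FP _ hF; apply; [exact: Ff|].
  - by move=> f [F hF Ff]; have [_ _ +] := FP _ hF; apply.
have Me : M e.
  (* N is the filter generated by M and e. *)
  pose N : set (J C) := fun g => \val e `<=` \val g \/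
    exists2 f, M f & \val f `&` \val e `<=` \val g.
  have PN : P N.
    split.
    - move=> g h [eg|[f Mf fg]] [eh|[f' Mf' fh]].
      + by left=> x ex; split; [exact: eg|exact: eh].
      + by right; exists f' => // x [f'x ex]; split; [exact: eg|exact: fh].
      + by right; exists f => // x [fx ex]; split; [exact: fg|exact: eh].
      + right; exists (Jcap f f'); first exact: MI.
        by move=> x [[fx f'x] ex]; split; [exact: fg|exact: fh].
    - move=> f g [ef|[k Mk kf]] fg; [left|right; exists k => //];
        exact: subset_trans fg.
    - move=> g [eg|[f Mf fg]].
        by have [x ex] := e0; exists x; split=> //; exact: eg.
      by have [x fx] := M0 _ Mf; exists x; split; [exact: fg|exact: fx.2].
  have MN : M `<=` N by move=> f Mf; right; exists f => // x [].
  apply: contrapT => nMe; apply: (Mmx N) PN; split=> // NM.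
  by apply: nMe; apply: NM; left.
have cM : is_character ((fun f => `[< M f >]) : {ptws J C -> bool}).
  split.
  - by exists e; apply/asboolP.
  - move=> f g; apply/asboolP/andP => [h|[/asboolP Mf /asboolP Mg]].
      by split; apply/asboolP; apply: MS h _ => x [].
    exact: MI.
  - by move=> f f0; apply/asboolP => /M0; rewrite f0 set0I => -[].
exists (SigSub (mem_set cM)); last exact/asboolP.
move=> psi sub; apply/seteqP; split=> // f /= hf.
apply/asboolP; apply: contrapT => nMf.
have he : ev psi e by apply: sub; apply/asboolP.
apply: (Mmx [set g | ev psi g]).
  split; last by move=> /(_ _ hf).
  by move=> g Mg; apply: sub; apply/asboolP.
split.
- by move=> g h /= hg hh; rewrite ev_cap hg.
- by move=> g h /= hg gh; exact: ev_sub hg.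
- move=> g hg; apply: (@ev_neq0 _ psi (Jcap g e)).
  by rewrite ev_cap; apply/andP.
Qed.

End Characters.

(** * Minimality of the partial action of I_l *)

Lemma filter_seq (I : eqType) (X : Type) (F : set_system X) (r : seq I)
    (P : I -> set X) : Filter F ->
  (forall i, i \in r -> F (P i)) -> F [set x | forall i, i \in r -> P i x].
Proof.
move=> FF; elim: r => [_|i r IH h]; first by apply: filterS filterT.
apply: filterS2 (h i (mem_head _ _)) (IH _) => [x hi hr j|j jr].
  by rewrite in_cons => /orP[/eqP->|/hr].
by apply: h; rewrite in_cons jr orbT.
Qed.

Section Minimality.
Variable C : lcCategory.

(** Invariance under the partial action of I_l on the boundary. *)
Definition stable (A : set (bdry C)) :=
  forall (s : Il C) (chi : bdry C) (h : xev chi (Idom s)), A chi <-> A (xact h).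

(** The boundary has no proper non-empty closed subset invariant under I_l. *)
Definition minimal_action :=
  forall A : set (bdry C), closed A -> stable A -> A = set0 \/ A = setT.

(** The base of germs affects which arrows are identified, but not which pairs
of points they connect; so it is irrelevant for minimality. *)
Lemma minimal_germP (T : germ_base C) :
  minimal (germ_groupoid T) <-> minimal_action.
Proof.
suff h (A : set (bdry C)) : @Defs.invariant (germ_groupoid T) A <-> stable A.
  by split=> mn A cA sA; apply: mn => //; apply/h.
split=> [iA s chi h|sA].
  have := iA (germ_of T (mkgpair h)).
  by rewrite /= germ_sourceE germ_targetE gpair_actE.
apply: (@germ_ind _ T) => p; rewrite /= germ_sourceE germ_targetE.
exact: sA.
Qed.

(** Condition (iii): finitely many translates of f are enough to meet every
non-empty element of J below e. *)
Definition finitely_covered :=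
  forall e f : set C, J C e -> J C f -> e !=set0 -> f !=set0 ->
    exists ss : seq (set (C * C)),
      (forall s, s \in ss -> Il C s) /\
      forall e' : set C, J C e' -> e' !=set0 -> e' `<=` e ->
        exists2 s, s \in ss & e' `&` pimg s f !=set0.

(** The conclusion says that the orbit of chi contains a character that is 1 at
f, namely s^-1.chi. *)
Lemma covered_orbit (chi : bdry C) (f : J C) : finitely_covered ->
  \val f !=set0 -> exists s, xev chi (Iconj s f).
Proof.
move=> cov f0; apply: contrapT => no.
have {}no s : ev (\val chi) (Iconj s f) = false by apply/negP => h; apply: no; exists s.
have [e he] := ev_ex (\val chi).
have [ss [ssI ssP]] := cov _ _ (set_valP e) (set_valP f) (ev_neq0 he) f0.
(* If no translate works, B is an open neighbourhood of chi, so it contains a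
   maximal character psi and all characters that are 1 at some k. *)
pose B := [set psi : Jhat C | ev psi e /\ forall s, s \in ss ->
  forall t : Il C, \val t = s -> ev psi (Iconj t f) = false].
have nB (psi : Jhat C) : B psi -> nbhs psi B.
  move=> [pe pf]; apply: filterI; first exact: near_ev.
  apply: filter_seq => s sss.
  apply: filterS (near_ev (pf s sss (SigSub (mem_set (ssI s sss))) erefl)).
  by move=> xi xif t ts; rewrite -xif; congr (ev xi (Iconj _ f)); exact: val_inj.
have [|psi [mpsi Bpsi]] := set_valP chi B; first by apply: nB; split.
have [k hk kB] := maximal_nbhs _ _ _ mpsi (nB _ Bpsi).
have ke0 : \val (Jcap k e) !=set0 by apply: (@ev_neq0 _ psi); rewrite ev_cap hk Bpsi.1.
have [|s sss ne] := ssP _ (set_valP (Jcap k e)) ke0; first by move=> x [].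
pose t : Il C := SigSub (mem_set (ssI s sss)).
(* xi is 1 at k, hence in B, and also at t f t^-1: a contradiction. *)
have [xi _] := @exists_maximal C (Jcap (Jcap k e) (Iconj t f)) ne.
rewrite !ev_cap => /andP[/andP[hxik _] hxi].
by have [_ /(_ s sss t erefl)] := kB _ hxik; rewrite hxi.
Qed.

Lemma covered_minimal : finitely_covered -> minimal_action.
Proof.
move=> cov A cA sA; have [[chi Achi]|A0] := pselect (A !=set0); last first.
  by left; apply/seteqP; split=> // psi Apsi; case: A0; exists psi.
right; apply/seteqP; split=> // psi _; apply: cA => B [_ [[V oV <-] /= Vpsi] VB].
have nV : nbhs (\val psi) V by exact: open_nbhs_nbhs.
have [phi [mphi Vphi]] := set_valP psi V nV.
have nV' : nbhs phi V by exact: open_nbhs_nbhs.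
have [f hf fV] := maximal_nbhs _ _ _ mphi nV'.
have [s hs] := covered_orbit chi f cov (ev_neq0 hf).
have h : xev chi (Idom (Iinv s)).
  by apply: ev_sub hs => y [x _ xy]; exists x.
exists (xact h); split; first exact/(sA _ _ h).
by apply/VB/fV; rewrite -[ev _ _]/(xev (xact h) f) xactE IinvK.
Qed.

(** These are the characters chi such that no point of the orbit of chi is 1
at f. *)
Lemma avoiding_stable (f : J C) :
  stable [set chi : bdry C | forall s, xev chi (Iconj s f) = false].
Proof.
have fwd s (chi : bdry C) (h : xev chi (Idom s)) :
    (forall t, xev chi (Iconj t f) = false) ->
    forall t, xev (xact h) (Iconj t f) = false.
  by move=> av t; rewrite xactE -Iconj_comp.
move=> s chi h; split; first exact: fwd.
have h' : xev (xact h) (Idom (Iinv s)) by exact: jact_invP.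
by move=> /(fwd _ _ h'); rewrite (_ : xact h' = chi) //; apply/val_inj/jactK.
Qed.

Lemma avoiding_closed (f : J C) :
  closed [set chi : bdry C | forall s, xev chi (Iconj s f) = false].
Proof.
move=> chi cl s; apply/negP => hs.
by have [psi [/= -> ]] := cl _ (near_xev hs).
Qed.

(** The characters whose orbits avoid f do not fill the boundary, since some
maximal character is 1 at f; by minimality there are none. *)
Lemma minimal_orbit (chi : bdry C) (f : J C) : minimal_action ->
  \val f !=set0 -> exists s, xev chi (Iconj s f).
Proof.
move=> mn f0; apply: contrapT => no.
have [s0|sT] := mn _ (avoiding_closed f) (avoiding_stable f).
  suff : (set0 : set (bdry C)) chi by [].
  by rewrite -s0 => s; apply/negP => hs; apply: no; exists s.
have [phi mphi hf] := exists_maximal _ _ f0.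
(* For the idempotent s with domain f one has s f s^-1 = f. *)
have [s sE] := idempotent_subproof f.
pose psi : bdry C := SigSub (mem_set (subset_closure mphi)).
have : [set: bdry C] psi by [].
rewrite -sT => /(_ s) /negP; apply; apply: ev_sub hf => x fx.
by exists x => //; rewrite sE.
Qed.

Lemma minimal_covered : minimal_action -> finitely_covered.
Proof.
move=> mn e f Je Jf e0 f0; apply: contrapT => nc.
pose f' : J C := SigSub (mem_set Jf); pose e1 : J C := SigSub (mem_set Je).
pose B (ss : seq (Il C)) := [set chi : Jhat C | [/\ maximal_characters chi,
  ev chi e1 & forall s, s \in ss -> ev chi (Iconj s f') = false]].
have B0 ss : B ss !=set0.
  apply: contrapT => nB; apply: nc; exists [seq \val s | s <- ss]; split.
    by move=> _ /mapP[s _ ->]; exact: set_valP.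
  move=> e' Je' e'0 e'e; apply: contrapT => av; apply: nB.
  have [chi mchi he'] := @exists_maximal C (SigSub (mem_set Je')) e'0.
  exists chi; split=> //; first exact: ev_sub he'.
  move=> s sss; apply/negP => hs; apply: av; exists (\val s); first exact: map_f.
  have : ev chi (Jcap (SigSub (mem_set Je')) (Iconj s f')).
    by rewrite ev_cap; apply/andP.
  exact: ev_neq0.
have FB : Filter (filter_from setT B).
  apply: filter_fromT_filter; first by exists [::].
  move=> r r'; exists (r ++ r') => chi [mchi he hs].
  by split; split=> // s sr; apply: hs; rewrite mem_cat sr ?orbT.
have [G [UG BG]] := ultraFilterLemma (filter_from_proper FB (fun ss _ => B0 ss)).
have GB ss : G (B ss) by apply: BG; exists ss.
have [||chi chiO Gchi] := ultra_dOmega _ G e1 UG.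
- by apply: filterS (GB [::]) => psi [].
- by apply: filterS (GB [::]) => psi [].
(* The limit chi vanishes at all s f s^-1, contradicting minimality. *)
have [s hs] := @minimal_orbit (SigSub (mem_set chiO)) f' mn f0.
have [psi [/= psis [_ _ psi0]]] :=
  filter_ex (filterI (Gchi (Iconj s f')) (GB [:: s])).
by move: hs; rewrite -[xev _ _]/(ev chi _) -psis psi0 // mem_head.
Qed.

End Minimality.

Theorem lemma5p4 (C : lcCategory) :
  [<-> minimal (Il_groupoid C);
       minimal (Il_groupoid_bar C);
       forall e f : set C, J C e -> J C f -> e !=set0 -> f !=set0 ->
         exists ss : seq (set (C * C)),
           (forall s, s \in ss -> Il C s) /\
           forall e' : set C, J C e' -> e' !=set0 -> e' `<=` e ->
             exists2 s, s \in ss & e' `&` pimg s f !=set0].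
Proof.
split; first by move/minimal_germP/(minimal_germP _ (base_Jbar C)).
split; first by move/minimal_germP/minimal_covered.
by move/covered_minimal/(minimal_germP _ (base_J C)).
Qed.
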